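(* Let $f:\mathbb{R}^m\to\mathbb{R}$ be convex and differentiable such that $\nabla f$ is $L$-Lipschitz continuous with respect to the Euclidean norm, $L>0$, and suppose there exists $x^*\in\mathbb{R}^m$ with $f(x^* )=\inf f$. Let $\sigma\ge0$ and $0<\eta<\frac{1}{L(1+\sigma^2)}$. Let $(X_n)_{n\ge0}$ be stochastic gradient iterates $X_{n+1}=X_n-\eta g_n$ with a random initial condition $X_0$ and gradient estimators $g_n$ such that, with $\mathcal{F}_n=\sigma(X_0,\dots,X_n)$ the $\sigma$-algebra generated by $X_0,\dots,X_n$, \[ \mathbb{E}[g_n\mid\mathcal{F}_n]=\nabla f(X_n),\qquad \mathbb{E}\big[\|g_n-\nabla f(X_n)\|^2\,\big|\,\mathcal{F}_n\big]\le\sigma^2\,\|\nabla f(X_n)\|^2\qquad\text{for all } n\ge 0. \] If $\mathbb{E}[f(X_0)+\|X_0\|^2]<\infty$, then $f(X_n)$ converges to $\inf f$ as $n\to\infty$ both almost surely and in $L^1$.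
   Context: All random variables are defined on a common probability space and take values in $\mathbb{R}^m$. $\|\cdot\|$ is the Euclidean norm. *)

(* Defs.v *)
From HB Require Import structures.
From mathcomp Require Import all_boot all_order all_algebra.
From mathcomp Require Import all_classical all_reals all_analysis
  measurable_realfun.

Set Implicit Arguments.
Unset Strict Implicit.
Unset Printing Implicit Defensive.

Import Order.TTheory GRing.Theory Num.Theory.
Import numFieldNormedType.Exports.

Local Open Scope classical_set_scope.
Local Open Scope ring_scope.

(* The library norm `|x| on 'rV[R]_m is the sup norm, hence this definition.
   The topology, and with it differentiability and the Borel sets, is the
   same for both norms. *)
Definition enorm (R : realType) (m : nat) (x : 'rV[R]_m) : R :=
  Num.sqrt (\sum_(i < m) x ord0 i ^+ 2).

Definition grad (R : realType) (m : nat) (f : 'rV[R]_m -> R) (x : 'rV[R]_m) :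
    'rV[R]_m :=
  \row_(i < m) 'D_(delta_mx ord0 i) f x.

Definition borel_rV (R : realType) (m : nat) : set (set 'rV[R]_m) :=
  <<s @open 'rV[R]_m >>.

Section random_vectors.
Context d (T : measurableType d) (R : realType) (P : probability T R).

Definition random_vector (m : nat) (X : T -> 'rV[R]_m) : Prop :=
  forall B, borel_rV B -> measurable (X @^-1` B).

Definition natural_filtration (m : nat) (X : nat -> T -> 'rV[R]_m) (n : nat) :
    set (set T) :=
  <<s \bigcup_(k in [set k | (k <= n)%N])
        preimage_set_system setT (X k) (@borel_rV R m) >>.

(* F is meant to be a sub-sigma-algebra of the measurable sets of T. *)
Definition sub_measurable (F : set (set T)) d' (U : measurableType d')
    (Z : T -> U) : Prop :=
  forall B, measurable B -> F (Z @^-1` B).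

(* Z is a version of E[Y | F], for Y integrable *)
Definition is_cond_exp (F : set (set T)) (Y Z : T -> R) : Prop :=
  [/\ P.-integrable setT (EFin \o Y),
      P.-integrable setT (EFin \o Z),
      sub_measurable F Z &
      forall A, F A ->
        (\int[P]_(w in A) (Z w)%:E = \int[P]_(w in A) (Y w)%:E)%E].

Definition is_cond_exp_rV (m : nat) (F : set (set T)) (Y Z : T -> 'rV[R]_m) :
    Prop :=
  forall i, is_cond_exp F (fun w => Y w ord0 i) (fun w => Z w ord0 i).

(* Z is a version of E[Y | F], for Y measurable and nonnegative but not
   necessarily integrable; hence Z is extended-real valued *)
Definition is_cond_exp_ge0 (F : set (set T)) (Y : T -> R) (Z : T -> \bar R) :
    Prop :=
  [/\ measurable_fun setT Y,
      forall w, 0 <= Y w,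
      forall w, (0 <= Z w)%E,
      sub_measurable F Z &
      forall A, F A ->
        (\int[P]_(w in A) Z w = \int[P]_(w in A) (Y w)%:E)%E].

Definition cvg_L1 (u : nat -> T -> R) (v : T -> R) : Prop :=
  [/\ forall n, P.-integrable setT (EFin \o u n),
      P.-integrable setT (EFin \o v) &
      'E_P[fun w => (`|u n w - v w|)%R]%E @[n --> \oo] --> 0%E].

End random_vectors.

(* Main.v *)
(* The Lyapunov function is E|X_n - x*|^2.  Put D_n = f(X_n) - inf f.  The
   descent lemma gives |grad f|^2 <= 2 L (f - inf f), and convexity gives
   f - inf f <= <grad f(x), x - x*>.  Since the noise g_n - grad f(X_n) is
   orthogonal in L^2 to the F_n-measurable vectors X_n - x* and grad f(X_n),
   expanding the square yields
     E|X_{n+1} - x*|^2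
       <= E|X_n - x*|^2 - 2 eta (1 - eta L (1 + sigma^2)) E D_n.
   The coefficient of E D_n is negative, hence the series of the E D_n
   converges: this gives E D_n -> 0, and D_n -> 0 almost surely because the
   series of the D_n has finite expectation.  No martingale convergence theorem
   is needed. *)
Require Import Defs.
From HB Require Import structures.
From mathcomp Require Import all_boot all_order all_algebra.
From mathcomp Require Import all_classical all_reals all_analysis
  measurable_realfun.
From mathcomp Require Import ring lra.

Set Implicit Arguments.
Unset Strict Implicit.
Unset Printing Implicit Defensive.

Import Order.TTheory GRing.Theory Num.Theory.
Import numFieldNormedType.Exports.

Local Open Scope classical_set_scope.
Local Open Scope ring_scope.

(** * Euclidean inner product and the Cauchy-Schwarz inequality *)

Section euclidean.
Context {R : realType} {m : nat}.
Implicit Types x y z : 'rV[R]_m.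

Definition edot x y : R := \sum_(i < m) x ord0 i * y ord0 i.

Lemma edotC x y : edot x y = edot y x.
Proof. by apply: eq_bigr => i _; rewrite mulrC. Qed.

Lemma edotDl x y z : edot (x + y) z = edot x z + edot y z.
Proof. by rewrite -big_split; apply: eq_bigr => i _; rewrite mxE mulrDl. Qed.

Lemma edotZl a x z : edot (a *: x) z = a * edot x z.
Proof. by rewrite mulr_sumr; apply: eq_bigr => i _; rewrite mxE mulrA. Qed.

Lemma edotDr x y z : edot z (x + y) = edot z x + edot z y.
Proof. by rewrite edotC edotDl !(edotC z). Qed.

Lemma edotZr a x z : edot z (a *: x) = a * edot z x.
Proof. by rewrite edotC edotZl (edotC z). Qed.

Lemma edotNl x z : edot (- x) z = - edot x z.
Proof. by rewrite -scaleN1r edotZl mulN1r. Qed.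

Lemma edotNr x z : edot z (- x) = - edot z x.
Proof. by rewrite edotC edotNl edotC. Qed.

Definition edotE := (edotDl, edotDr, edotNl, edotNr, edotZl, edotZr).

Lemma edot_ge0 x : 0 <= edot x x.
Proof. by apply: sumr_ge0 => i _; rewrite -expr2 sqr_ge0. Qed.

Lemma sqr_enorm x : enorm x ^+ 2 = edot x x.
Proof.
rewrite sqr_sqrtr; first by apply: eq_bigr => i _; rewrite expr2.
by apply: sumr_ge0 => i _; rewrite sqr_ge0.
Qed.

Lemma enorm_ge0 x : 0 <= enorm x. Proof. exact: sqrtr_ge0. Qed.

Lemma enormZ a x : 0 <= a -> enorm (a *: x) = a * enorm x.
Proof.
move=> a0; apply/eqP; rewrite -(@eqrXn2 _ 2) ?mulr_ge0 ?enorm_ge0 //.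
by rewrite exprMn !sqr_enorm !edotE mulrA -expr2.
Qed.

Lemma edot_eq0 x : edot x x = 0 -> x = 0.
Proof.
move=> /eqP; rewrite psumr_eq0 => [|i _]; last by rewrite -expr2 sqr_ge0.
move=> /allP x0; apply/rowP => i; rewrite mxE; apply/eqP.
by have := x0 i (mem_index_enum _); rewrite mulf_eq0 orbb.
Qed.

(** With c = <y, y> and b = <x, y>, the squared norm of c x - b y is c (<x, x> c - b^2), and c can
    be cancelled when y is nonzero. The case b <= 0 is split off because the conclusion is reached
    by comparing squares. *)
Lemma cauchy_schwarz x y : edot x y <= enorm x * enorm y.
Proof.
have [y0|y0] := eqVneq (edot y y) 0.
  rewrite (edot_eq0 y0) (_ : edot x 0 = 0) ?mulr_ge0 ?enorm_ge0 //.
  by rewrite -(scale0r 0) edotZr mul0r.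
have y_gt0 : 0 < edot y y by rewrite lt0r y0 edot_ge0.
have [xy|/ltW xy] := leP (edot x y) 0.
  by rewrite (le_trans xy) // mulr_ge0 ?enorm_ge0.
rewrite -(@ler_pXn2r _ 2) ?nnegrE ?mulr_ge0 ?enorm_ge0 // exprMn !sqr_enorm.
have := edot_ge0 (edot y y *: x - edot x y *: y).
rewrite !edotE (edotC y x).
set a := edot x x; set b := edot x y; set c := edot y y => h.
have : 0 <= c * (a * c - b ^+ 2) by nra.
by rewrite pmulr_rge0 // subr_ge0.
Qed.

End euclidean.

(** * Convex and smooth functions: tangent bound, descent lemma, gradient bound *)

Section smooth.
Context {R : realType} {m : nat} (f : 'rV[R]_m -> R)
  (f_diff : forall x, differentiable f x).

Lemma derive_grad x v : 'D_v f x = edot (grad f x) v.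
Proof.
rewrite deriveE // [in LHS](row_sum_delta v) linear_sum /=.
by apply: eq_bigr => i _; rewrite linearZ /= mxE deriveE // mulrC.
Qed.

(** The difference quotient of the restriction to the line, at t, is the difference quotient of f at
    x + t v in the direction v. *)
Lemma is_derive_line x v (t : R) :
  is_derive t 1 (fun s : R => f (x + s *: v)) (edot (grad f (x + t *: v)) v).
Proof.
have E : (fun h : R => h^-1 *: (f (x + (h *: 1 + t) *: v) - f (x + t *: v))) =
    (fun h : R => h^-1 *: (f (h *: v + (x + t *: v)) - f (x + t *: v))).
  by apply/funext => h; rewrite scalerDl addrCA -[h *: 1]/(h * 1) mulr1.
apply: DeriveDef.
  rewrite /derivable /= E; exact: diff_derivable.
by rewrite /derive /= E -derive_grad.
Qed.

(** For 0 < h <= 1 convexity bounds the quotient (f(x + h (y - x)) - f(x)) / h by f(y) - f(x); then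
    h tends to 0 from the right. *)
Lemma convex_ge_tangent (x y : 'rV[R]_m) :
  convex_function [set: convex_lmodType 'rV[R]_m] f ->
  f x + edot (grad f x) (y - x) <= f y.
Proof.
move=> cf; rewrite addrC -lerBrDr -derive_grad.
have dv : derivable f x (y - x) by exact: diff_derivable.
apply: (cvgr_to_le (cvg_dnbhs_at_right dv)).
near=> h.
have h0 : 0 < h by [].
have h1 : h <= 1 by near: h; exact: nbhs_right_le.
rewrite -[_ *: _]/(h^-1 * (f (h *: (y - x) + x) - f x)) ler_pdivrMl //.
have := cf (Itv01 (ltW h0) h1) y x (in_setT _) (in_setT _).
rewrite convRE /= /conv /= /unstable.onem.
have -> : h *: y + (1 - h) *: x = h *: (y - x) + x.
  by rewrite scalerBl scale1r scalerBr addrAC addrA.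
move=> ?; nra.
Unshelve. all: by end_near. Qed.

(** The auxiliary [h] is f along the segment minus the linear and quadratic terms of the bound. By
    Cauchy-Schwarz and the Lipschitz condition its derivative is nonpositive on (0, 1), and the
    claim is [h 1 <= h 0]. *)
Lemma descent (L : R) x v : 0 < L ->
  (forall x y, enorm (grad f x - grad f y) <= L * enorm (x - y)) ->
  f (x + v) <= f x + edot (grad f x) v + L / 2 * edot v v.
Proof.
move=> L0 lip.
pose h (t : R) :=
  f (x + t *: v) - t * edot (grad f x) v - t ^+ 2 * (L / 2 * edot v v).
have dh (t : R) : is_derive t 1 h
    (edot (grad f (x + t *: v)) v - edot (grad f x) v - t * (L * edot v v)).
  pose E := is_derive_line x v t.
  apply: is_derive_eq.
  rewrite /GRing.scale /=.
  by field.
have : h 1 <= h 0.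
  apply: (@ler0_derive1_nincr _ h 0 1) => //.
- move=> t; rewrite in_itv => /andP[t0 _]; rewrite derive1E derive_val.
  have t0' : 0 < t by [].
  rewrite -edotNl -edotDl subr_le0 (le_trans (cauchy_schwarz _ _)) //.
  have := lip (x + t *: v) x; rewrite [x + _]addrC addrK => lip_t.
  have -> : t * (L * edot v v) = L * (t * enorm v) * enorm v.
    by rewrite -sqr_enorm; ring.
  rewrite ler_wpM2r ?enorm_ge0 // (le_trans lip_t) // ler_wpM2l ?(ltW L0) //.
  by rewrite enormZ ?lexx // ltW.
- by apply: derivable_within_continuous => t _.
by rewrite /h scale0r addr0 scale1r; lra.
Qed.

(** The step v = - grad f(x) / L minimizes the right-hand side of [descent], and the value of f
    reached after it is still at least b. *)
Lemma grad_sq_le (L b : R) x : 0 < L ->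
  (forall x y, enorm (grad f x - grad f y) <= L * enorm (x - y)) ->
  (forall y, b <= f y) ->
  edot (grad f x) (grad f x) <= 2 * L * (f x - b).
Proof.
move=> L0 lip fb.
have := descent x (- L^-1 *: grad f x) L0 lip.
rewrite !edotE => /(le_trans (fb _)).
set G := edot _ _.
have -> : f x + - L^-1 * G + L / 2 * (- L^-1 * (- L^-1 * G)) =
    f x - G / (2 * L) by field; rewrite gt_eqF.
by rewrite lerBrDl addrC -lerBrDl ler_pdivrMr ?mulr_gt0 // mulrC.
Qed.

End smooth.

(** * Integrability tools and orthogonality of centred noise, scalar case *)

Section orthogonality.
Context d (T : measurableType d) (R : realType) (P : probability T R).

Lemma EFin_integrableD (f g : T -> R) :
  P.-integrable setT (EFin \o f) -> P.-integrable setT (EFin \o g) ->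
  P.-integrable setT (EFin \o (fun w => f w + g w)).
Proof. exact: integrableD. Qed.

Lemma EFin_integrableB (f g : T -> R) :
  P.-integrable setT (EFin \o f) -> P.-integrable setT (EFin \o g) ->
  P.-integrable setT (EFin \o (fun w => f w - g w)).
Proof. exact: integrableB. Qed.

Lemma EFin_integrableZl (k : R) (f : T -> R) :
  P.-integrable setT (EFin \o f) ->
  P.-integrable setT (EFin \o (fun w => k * f w)).
Proof. by move=> fi; exact: (integrableZl _ k fi). Qed.

Lemma EFin_integrable_sum (I : Type) (r : seq I) (f : I -> T -> R) :
  (forall i, P.-integrable setT (EFin \o f i)) ->
  P.-integrable setT (EFin \o (fun w => \sum_(i <- r) f i w)).
Proof.
move=> fi; elim: r => [|i r IH].
  under [X in _ \o X]eq_fun do rewrite big_nil.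
  exact: integrable0.
under [X in _ \o X]eq_fun do rewrite big_cons.
exact: EFin_integrableD.
Qed.

Lemma EFin_le_integrable (f g : T -> R) : measurable_fun setT f ->
  (forall w, `|f w| <= g w) -> P.-integrable setT (EFin \o g) ->
  P.-integrable setT (EFin \o f).
Proof.
move=> mf fg; apply: le_integrable => //; first exact/measurable_EFinP.
by move=> w _; rewrite /= lee_fin (le_trans (fg w)) // ler_norm.
Qed.

Lemma floor_fiberE (e : R) (z : int) : 0 < e ->
  [set x : R | Num.floor (x / e) = z] = `[z%:~R * e, (z + 1)%:~R * e[%classic.
Proof.
move=> e0; apply/seteqP; split => x /=; rewrite in_itv /=.
- by move=> <-; rewrite -ler_pdivlMr // -ltr_pdivrMr // floor_itv.
- by rewrite -ler_pdivlMr // -ltr_pdivrMr // => /floor_def.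
Qed.

Lemma floor_dist (e x : R) : 0 < e -> `|x - e * (Num.floor (x / e))%:~R| <= e.
Proof.
move=> e0; have /andP[] := floor_itv (x / e).
rewrite ler_pdivlMr // ltr_pdivrMr // intrD rmorph1 => h1 h2.
by rewrite ler_norml; apply/andP; split; nra.
Qed.

(* [V] is approximated by [e * floor (V / e)], which is constant on countably
   many [F]-measurable sets, on each of which [xi] integrates to 0. *)
Lemma Rintegral_mul_orthogonal (F : set (set T)) (V xi : T -> R) :
  measurable_fun setT V -> sub_measurable F V ->
  P.-integrable setT (EFin \o xi) ->
  P.-integrable setT (EFin \o (fun w => V w * xi w)) ->
  (forall A, F A -> measurable A -> (\int[P]_(w in A) (xi w)%:E = 0)%E) ->
  \int[P]_w (V w * xi w) = 0.
Proof.
move=> mV FV ixi iVxi xi0.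
have mxi : measurable_fun setT xi.
  by apply/measurable_EFinP; exact: measurable_int ixi.
suff bound e : 0 < e -> `|\int[P]_w (V w * xi w)| <= e * \int[P]_w `|xi w|.
  have C0 : 0 <= \int[P]_w `|xi w| by apply: Rintegral_ge0.
  apply/eqP; rewrite -normr_le0; apply/ler_addgt0Pl => e e0; rewrite addr0.
  (* The bound is used at [e] divided by E|xi| + 1; the added 1 covers the case E|xi| = 0. *)
  have C1 : 0 < \int[P]_w `|xi w| + 1 by rewrite ltr_wpDl.
  rewrite (le_trans (bound _ (divr_gt0 e0 C1))) // mulrAC ler_pdivrMr //.
  by rewrite ler_pM2l // lerDl.
move=> e0.
pose q w := Num.floor (V w / e).
pose U w := e * (q w)%:~R.
(* [pickle] indexes the fibres of [q] by natural numbers, as countable additivity requires; a [k]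
   that codes no integer gives the empty set. *)
pose B k := [set w | pickle (q w) = k].
have BE k : exists2 C, measurable C & B k = V @^-1` C.
  have [[z zk]|nz] := pselect (exists z : int, pickle z = k).
    exists [set x | Num.floor (x / e) = z].
      by rewrite floor_fiberE; first exact: measurable_itv.
    apply/seteqP; split => w; rewrite /B /q /= -zk.
      exact: (pcan_inj pickleK).
    by move=> ->.
  exists set0 => //; rewrite preimage_set0 -subset0 => w qk.
  by apply: nz; exists (q w).
have mB k : measurable (B k).
  by have [C mC ->] := BE k; rewrite -[_ @^-1` _]setTI; exact: mV.
have FB k : F (B k) by have [C mC ->] := BE k; exact: FV.
have UB : \bigcup_k B k = setT.
  by apply/seteqP; split => // w _; exists (pickle (q w)).
have mU : measurable_fun setT U.
  apply: (measurableT_comp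
    (f := fun x : R => e * (Num.floor (x / e))%:~R)) => //.
  apply: nondecreasing_measurable => // x y xy.
  by rewrite ler_pM2l // ler_int le_floor // ler_pM2r ?invr_gt0.
have iUVxi : P.-integrable setT (EFin \o (fun w => (V w - U w) * xi w)).
  apply: (@EFin_le_integrable _ (fun w => e * `|xi w|)).
  - by apply: measurable_funM => //; exact: measurable_funB.
  - by move=> w; rewrite normrM ler_wpM2r //; exact: floor_dist.
  - by apply: EFin_integrableZl; exact: integrable_norm.
(* Neither V nor U need be bounded or integrable: U xi is the difference of V xi, integrable by
   hypothesis, and (V - U) xi, dominated by e |xi|. *)
have iUxi : P.-integrable setT (EFin \o (fun w => U w * xi w)).
  rewrite (_ : (fun w => _) = (fun w => V w * xi w - (V w - U w) * xi w)).
    exact: EFin_integrableB.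
  by apply/funext => w; rewrite mulrBl opprB addrCA subrr addr0.
have U0 : \int[P]_w (U w * xi w) = 0.
  rewrite /Rintegral -UB integral_bigcup ?UB //; last first.
    by move=> i j _ _ [w []]; rewrite /B /= => -> ->.
  rewrite eseries0 // => k _ _.
  have [[z zk]|nz] := pselect (exists z : int, pickle z = k).
    rewrite (eq_integral (fun w => (e * z%:~R)%:E * (xi w)%:E)%E).
      rewrite integralZl // ?xi0 ?mule0 //.
      exact: integrableS ixi.
    move=> w /set_mem; rewrite /B /= -zk => /(pcan_inj pickleK) qz.
    by rewrite /U qz EFinM.
  rewrite (_ : B k = set0) ?integral_set0 // -subset0 => w qk.
  by apply: nz; exists (q w).
rewrite -[X in `|X|]subr0 -U0 -RintegralB //.
rewrite -RintegralZl //; last exact: integrable_norm.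
under eq_Rintegral do rewrite -mulrBl.
rewrite (le_trans (le_normr_Rintegral _ _)) //.
apply: le_Rintegral => //.
- exact: integrable_norm.
- by apply: EFin_integrableZl; exact: integrable_norm.
move=> w _; rewrite normrM ler_wpM2r //; exact: floor_dist.
Qed.
End orthogonality.

(** * Measurability of vector-valued maps *)

Section measurability.
Context d (T : measurableType d) (R : realType).

(** The preimage is a countable union of fibres. Since [C] is arbitrary, it may be taken as the set
    of grid cells contained in an open set. *)
Lemma measurable_preimage_countType (I : countType) (q : T -> I) (C : set I) :
  (forall c, measurable [set w | q w = c]) -> measurable (q @^-1` C).
Proof.
move=> mq; rewrite (_ : _ @^-1` _ = \bigcup_c [set w | q w = c /\ C c]).
  apply: countable_bigcupT_measurable => [|c]; first exact: countableP.
  have [Cc|nCc] := pselect (C c).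
    rewrite (_ : [set _ | _] = [set w | q w = c]) //.
    by apply/seteqP; split => w // [].
  by rewrite (_ : [set _ | _] = set0) //; apply/seteqP; split => w // [].
by apply/seteqP; split => [w Cw|w [c _ [<-]]] //; exists (q w).
Qed.

(** Open sets generate the Borel sets, and an open set is a countable union of grid cells, each
    defined by finitely many conditions on single coordinates. This makes the iterates random
    vectors, their update being checked coordinate by coordinate. *)
Lemma random_vector_coord (m : nat) (X : T -> 'rV[R]_m) :
  (forall i, measurable_fun setT (fun w => X w ord0 i)) -> random_vector X.
Proof.
move=> mX.
suff oX U : open U -> measurable (X @^-1` U).
  have mX' : measurable_fun setT
      (X : T -> g_sigma_algebraType (@open 'rV[R]_m)).
    apply: (@measurability _ _ T (g_sigma_algebraType (@open 'rV[R]_m)) setT X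
      (@open 'rV[R]_m)) => // _ [U oU <-].
    by rewrite setTI; exact: oX.
  by move=> B bB; rewrite -[_ @^-1` _]setTI; exact: mX'.
move=> oU.
pose e n : R := n.+1%:R^-1.
have e0 n : 0 < e n by rewrite invr_gt0.
pose q n (x : 'rV[R]_m) : 'rV[int]_m := \row_i Num.floor (x ord0 i / e n).
(* [U] is the union of the cells of the grids [e n * Z^m] that it contains. *)
rewrite (_ : _ @^-1` _ = \bigcup_n
    ((q n \o X) @^-1` [set c | forall x, q n x = c -> U x])).
  apply: bigcup_measurable => n _; apply: measurable_preimage_countType => c.
  rewrite (_ : [set w | _] = \bigcap_(i in [set: 'I_m])
    ((fun w => X w ord0 i) @^-1` [set x | Num.floor (x / e n) = c ord0 i])).
    apply: fin_bigcap_measurable => // i _; rewrite -[X in measurable X]setTI.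
    by apply: mX => //; rewrite floor_fiberE; first exact: measurable_itv.
  apply/seteqP; split => [w <- i _|w cw]; first by rewrite /= mxE.
  by apply/rowP => i; rewrite mxE cw.
apply/seteqP; split => [w Uw|w [n _]]; last exact.
have /nbhs_ballP[r /= r0 rU] : nbhs (X w) U by exact: open_nbhs_nbhs.
(* A point in the same cell as X w is within 2 [e n] of it in every coordinate, going through the
   corner of the cell; so [e n] below r / 2 suffices for the sup-norm ball. *)
near \oo => n.
exists n => // x /rowP qx; apply: rU; split => // i j.
rewrite [i]ord1; have := qx j; rewrite !mxE => E.
have := floor_dist (X w ord0 j) (e0 n); have := floor_dist (x ord0 j) (e0 n).
rewrite distrC E; set c := e n * _ => xc Xc.
rewrite /ball /= (le_lt_trans (ler_distD c _ _)) //.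
rewrite (le_lt_trans (lerD Xc xc)) //.
have en : e n < r / 2.
  near: n; have r2 : 0 < r / 2 by rewrite divr_gt0.
  exact: near_infty_natSinv_lt (PosNum r2).
by rewrite [ltRHS]splitr ltrD.
Unshelve. all: by end_near. Qed.

Lemma borel_rV_continuous (m : nat) (h : 'rV[R]_m -> R) (B : set R) :
  continuous h -> measurable B -> borel_rV (h @^-1` B).
Proof.
move=> /continuousP ch mB.
have mh : measurable_fun setT (h : g_sigma_algebraType (@open 'rV[R]_m) -> R).
  apply: (measurability (@RGenOpens.G R)); first exact: RGenOpens.measurableE.
  move=> _ [_ [a [b ->]] <-]; rewrite setTI.
  by apply: sub_sigma_algebra; apply: ch; exact: interval_open.
by have := mh measurableT _ mB; rewrite setTI.
Qed.

Lemma measurable_random_vector (m : nat) (h : 'rV[R]_m -> R)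
    (X : T -> 'rV[R]_m) :
  continuous h -> random_vector X -> measurable_fun setT (h \o X).
Proof.
move=> ch rX _ B mB; rewrite setTI.
exact: (rX (h @^-1` B) (borel_rV_continuous ch mB)).
Qed.

End measurability.

(** * Integrability from one-sided bounds and almost sure convergence to 0 *)

Section limits.
Context d (T : measurableType d) (R : realType) (P : probability T R).

Lemma ge0_integrable (u : T -> R) : measurable_fun setT u ->
  (forall w, 0 <= u w) -> (\int[P]_w (u w)%:E < +oo)%E ->
  P.-integrable setT (EFin \o u).
Proof.
move=> mu u0 iu; apply/integrableP; split; first exact/measurable_EFinP.
by under eq_integral do rewrite /= ger0_norm //.
Qed.

(** The negative part [un] is at most |b|, hence integrable, so an integral of u below +oo forces
    the positive part u + un to be integrable. This serves the moment condition on X_0, which is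
    only an upper bound while f may take negative values. *)
Lemma lbounded_integrable (u : T -> R) (b : R) : measurable_fun setT u ->
  (forall w, b <= u w) -> (\int[P]_w (u w)%:E < +oo)%E ->
  P.-integrable setT (EFin \o u).
Proof.
move=> mu ub iu.
pose un w := Num.max (- u w) 0.
have mun : measurable_fun setT un.
  by apply: measurable_maxr => //; exact: measurableT_comp.
have iun : P.-integrable setT (EFin \o un).
  apply: (@EFin_le_integrable _ _ _ _ _ (cst `|b|)) => //.
    move=> w; rewrite ger0_norm; last by rewrite le_max lexx orbT.
    rewrite ge_max /= normr_ge0 andbT.
    by have := ub w; have := ler_norm (- b); rewrite normrN; lra.
  exact: finite_measure_integrable_cst.
have iup : P.-integrable setT (EFin \o (fun w => u w + un w)).
  apply: ge0_integrable.
  - exact: measurable_funD.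
  - by move=> w; rewrite /un addrC -lerBlDr sub0r le_max lexx.
  - move: iu; rewrite integralE.
    under eq_integral => w _.
      rewrite funeposE -EFin_max (_ : Num.max _ _ = u w + un w); last first.
        by rewrite /un addr_maxr subrr addr0 maxC.
      over.
    under [X in (_ - X)%E]eq_integral => w _.
      rewrite funenegE -EFinN -EFin_max -/(un w); over.
    have /integrable_fin_num -/(_ measurableT) nfin := iun.
    by rewrite lteBlDr // => /lt_le_trans -> //; rewrite leey.
rewrite (_ : u = fun w => u w + un w - un w); first exact: EFin_integrableB.
by apply/funext => w; rewrite addrK.
Qed.

Lemma bounded_series_cvg0 (u : R^nat) (C : R) : (forall n, 0 <= u n) ->
  (forall n, \sum_(k < n) u k <= C) -> u n @[n --> \oo] --> 0.
Proof.
move=> u0 uC; apply: cvg_series_cvg_0; apply: nondecreasing_is_cvgn.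
  by apply/nondecreasing_seqP => n; rewrite seriesEord /= big_ord_recr lerDl.
by exists C => _ [n _ <-]; rewrite seriesEord /=; exact: uC.
Qed.

(** By monotone convergence the sum of the series has integral at most C, so it is finite almost
    everywhere, and there the terms tend to 0. *)
Lemma summable_ae_cvg0 (D : nat -> T -> R) (C : R) :
  (forall n, measurable_fun setT (D n)) -> (forall n w, 0 <= D n w) ->
  (forall n, (\sum_(k < n) \int[P]_w (D k w)%:E <= C%:E)%E) ->
  {ae P, forall w, D n w @[n --> \oo] --> 0}.
Proof.
move=> mD D0 DC.
have mD' n : measurable_fun setT (EFin \o D n) by exact/measurable_EFinP.
have mS : measurable_fun setT (fun w => \sum_(n <oo) (D n w)%:E)%E.
  by apply: ge0_emeasurable_sum => [n w _ _|n _]; [rewrite lee_fin|exact: mD'].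
have iS : P.-integrable setT (fun w => \sum_(n <oo) (D n w)%:E)%E.
  apply/integrableP; split => //.
  rewrite (eq_integral (fun w => \sum_(n <oo) (D n w)%:E)%E); last first.
    by move=> w _; rewrite gee0_abs //;
      apply: nneseries_ge0 => n _ _; rewrite lee_fin.
  rewrite integral_nneseries //; last by move=> n w _; rewrite lee_fin.
  apply: (@le_lt_trans _ _ C%:E); last by rewrite ltry.
  apply: lime_le.
    by apply: is_cvg_nneseries => n _ _;
      apply: integral_ge0 => w _; rewrite lee_fin.
  by apply: nearW => n; rewrite big_mkord.
have := integrable_ae measurableT iS.
apply: filterS => w /(_ I) Sfin.
apply: (@bounded_series_cvg0 _ (fine (\sum_(n <oo) (D n w)%:E)%E)) => // n.
rewrite -lee_fin fineK // -sumEFin -(big_mkord xpredT (fun k => (D k w)%:E)).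
by apply: nneseries_lim_ge => k _ _; rewrite lee_fin.
Qed.

End limits.

(** * Orthogonality of centred noise, vector case *)

Section orthogonality_rV.
Context d (T : measurableType d) (R : realType) (P : probability T R) (m : nat).
Implicit Types V xi : T -> 'rV[R]_m.

Lemma sqr_coord_le (x : 'rV[R]_m) i : x ord0 i ^+ 2 <= edot x x.
Proof.
rewrite /edot (bigD1 i) //= -expr2 lerDl sumr_ge0 // => j _.
by rewrite -expr2 sqr_ge0.
Qed.

Lemma measurable_edot V xi :
  (forall i, measurable_fun setT (fun w => V w ord0 i)) ->
  (forall i, measurable_fun setT (fun w => xi w ord0 i)) ->
  measurable_fun setT (fun w => edot (V w) (xi w)).
Proof. by move=> mV mxi; apply: measurable_sum => i; exact: measurable_funM. Qed.

(** The scalar result is applied to each coordinate; the products V_i xi_i it asks to be integrable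
    are dominated by |V|^2 + |xi|^2. *)
Lemma Rintegral_edot_orthogonal (F : set (set T)) V xi :
  (forall i, measurable_fun setT (fun w => V w ord0 i)) ->
  (forall i, sub_measurable F (fun w => V w ord0 i)) ->
  P.-integrable setT (EFin \o (fun w => edot (V w) (V w))) ->
  (forall i, P.-integrable setT (EFin \o (fun w => xi w ord0 i))) ->
  P.-integrable setT (EFin \o (fun w => edot (xi w) (xi w))) ->
  (forall A i, F A -> measurable A ->
    (\int[P]_(w in A) (xi w ord0 i)%:E = 0)%E) ->
  P.-integrable setT (EFin \o (fun w => edot (V w) (xi w))) /\
  \int[P]_w (edot (V w) (xi w)) = 0.
Proof.
move=> mV FV iV ixi ixi2 xi0.
have mxi i : measurable_fun setT (fun w => xi w ord0 i).
  by apply/measurable_EFinP; exact: measurable_int (ixi i).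
have iVxi i : P.-integrable setT (EFin \o (fun w => V w ord0 i * xi w ord0 i)).
  apply: (EFin_le_integrable _ _ (EFin_integrableD iV ixi2)).
    exact: measurable_funM.
  move=> w; rewrite normrM.
  have := sqr_coord_le (V w) i; have := sqr_coord_le (xi w) i.
  rewrite -(real_normK (num_real (V w ord0 i))).
  rewrite -(real_normK (num_real (xi w ord0 i))).
  set a := `|V w ord0 i|; set b := `|xi w ord0 i|.
  have := sqr_ge0 (a - b); have := sqr_ge0 (a + b).
  nra.
split; first exact: EFin_integrable_sum.
have sum0 (r : seq 'I_m) :
    \int[P]_w (\sum_(i <- r) V w ord0 i * xi w ord0 i) = 0.
  elim: r => [|i r IH].
    under eq_Rintegral do rewrite big_nil.
    by rewrite Rintegral_cst // mul0r.
  under eq_Rintegral do rewrite big_cons.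
  rewrite RintegralD //; last exact: EFin_integrable_sum.
  rewrite IH addr0.
  apply: (Rintegral_mul_orthogonal (mV i) (FV i) (ixi i) (iVxi i)) => A FA mA.
  exact: xi0.
exact: sum0.
Qed.

End orthogonality_rV.

(** * One step of stochastic gradient descent in expectation *)

Section sgd_step.
Context d (T : measurableType d) (R : realType) (P : probability T R) (m : nat).

Lemma measurable_coord (Y : T -> 'rV[R]_m) i :
  random_vector Y -> measurable_fun setT (fun w => Y w ord0 i).
Proof.
by apply: (@measurable_random_vector _ _ _ _ (fun x => x ord0 i));
  exact: coord_continuous.
Qed.

Lemma natural_filtration_measurable (X : nat -> T -> 'rV[R]_m) n :
  (forall k, random_vector (X k)) -> natural_filtration X n `<=` measurable.
Proof.
move=> rX; apply: smallest_sub; first exact: sigma_algebra_measurable.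
by move=> _ [k _ [B bB <-]]; rewrite setTI; exact: rX.
Qed.

Lemma natural_filtration_continuous (X : nat -> T -> 'rV[R]_m) n
    (h : 'rV[R]_m -> R) :
  continuous h -> sub_measurable (natural_filtration X n) (h \o X n).
Proof.
move=> ch B mB; apply: sub_sigma_algebra; exists n => //=.
exists (h @^-1` B); first exact: borel_rV_continuous.
by rewrite setTI.
Qed.

(** Write v = x - xs, G = grad f(x), xi = g - G and expand |v - eta G - eta xi|^2. The term -2 eta
    <v, G> is at most -2 eta D, and eta^2 |G|^2 at most 2 L eta^2 D; the products with xi have mean
    0, and E|xi|^2 <= sigma^2 E|G|^2. Integrability is propagated along with the inequality, so that
    the step can be iterated. *)
Lemma sgd_step (F : set (set T)) (f : 'rV[R]_m -> R) (L sigma eta b : R)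
    (xs : 'rV[R]_m) (x x' g : T -> 'rV[R]_m) (Z : T -> \bar R) :
  let S w := edot (x w - xs) (x w - xs) in
  let S' w := edot (x' w - xs) (x' w - xs) in
  let D w := f (x w) - b in
  0 < L -> 0 < eta -> continuous f ->
  (forall y, edot (grad f y) (grad f y) <= 2 * L * (f y - b)) ->
  (forall y, 0 <= f y - b) ->
  (forall y, f y - b <= edot (grad f y) (y - xs)) ->
  (forall y, f y - b <= L / 2 * edot (y - xs) (y - xs)) ->
  sigma_algebra setT F -> F `<=` measurable ->
  random_vector x -> random_vector x' -> random_vector g ->
  (forall h : 'rV[R]_m -> R, continuous h -> sub_measurable F (h \o x)) ->
  (forall w, x' w = x w - eta *: g w) ->
  is_cond_exp_rV P F g (fun w => grad f (x w)) ->
  is_cond_exp_ge0 P F (fun w => enorm (g w - grad f (x w)) ^+ 2) Z ->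
  {ae P, forall w, (Z w <= (sigma ^+ 2 * enorm (grad f (x w)) ^+ 2)%:E)%E} ->
  P.-integrable setT (EFin \o S) ->
  [/\ P.-integrable setT (EFin \o S'), P.-integrable setT (EFin \o D) &
   \int[P]_w S' w <= \int[P]_w S w -
     2 * eta * (1 - eta * (L * (1 + sigma ^+ 2))) * \int[P]_w D w].
Proof.
move=> S S' D L0 eta0 cf gradD D0 Dsub Dquad sF Fm rx rx' rg Fx xE cg
  [mW W0 Z0 FZ ZE] Zle iS.
have FT : F setT by rewrite -(setD0 setT); case: sF => F0 FC _; exact: FC.
pose G w := grad f (x w).
pose xi w := g w - G w.
have xiE w i : xi w ord0 i = g w ord0 i - G w ord0 i by rewrite !mxE.
have iG i : P.-integrable setT (EFin \o (fun w => G w ord0 i)) by case: (cg i).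
have ig i : P.-integrable setT (EFin \o (fun w => g w ord0 i)) by case: (cg i).
have mG i : measurable_fun setT (fun w => G w ord0 i).
  by apply/measurable_EFinP; exact: measurable_int (iG i).
have mx i : measurable_fun setT (fun w => (x w - xs) ord0 i).
  under eq_fun do rewrite !mxE.
  by apply: measurable_funB => //; exact: measurable_coord.
have mx' i : measurable_fun setT (fun w => (x' w - xs) ord0 i).
  under eq_fun do rewrite !mxE.
  by apply: measurable_funB => //; exact: measurable_coord.
have mD : measurable_fun setT D.
  by apply: measurable_funB => //; exact: measurable_random_vector.
(* Integrability passes from S to D through [Dquad], then from D to |G|^2 through [gradD]. *)
have iD : P.-integrable setT (EFin \o D).
  apply: (EFin_le_integrable mD _ (EFin_integrableZl (L / 2) iS)) => w.
  by rewrite ger0_norm; [exact: Dquad|exact: D0].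
have iGG : P.-integrable setT (EFin \o (fun w => edot (G w) (G w))).
  apply: (EFin_le_integrable _ _ (EFin_integrableZl (2 * L) iD)).
    exact: measurable_edot.
  by move=> w; rewrite ger0_norm ?edot_ge0 //; exact: gradD.
have WE w : enorm (g w - grad f (x w)) ^+ 2 = edot (xi w) (xi w).
  exact: sqr_enorm.
have mZ : measurable_fun setT Z.
  by move=> _ B mB; rewrite setTI; apply: Fm; exact: FZ.
(* Testing the conditional expectation [Z] on the whole space removes the conditioning. The
   integrals are extended-real because the integrability of |xi|^2 is only deduced afterwards, from
   this bound. *)
have intW : (\int[P]_w (edot (xi w) (xi w))%:E <=
    \int[P]_w (sigma ^+ 2 * edot (G w) (G w))%:E)%E.
  under eq_integral do rewrite -WE.
  rewrite -ZE //; apply: ae_ge0_le_integral => //.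
  - by move=> w _; rewrite lee_fin mulr_ge0 ?sqr_ge0 ?edot_ge0.
  - apply/measurable_EFinP/measurable_funM => //; exact: measurable_edot.
  - by apply: filterS Zle => w; rewrite sqr_enorm.
have isGG := EFin_integrableZl (sigma ^+ 2) iGG.
have ixi i : P.-integrable setT (EFin \o (fun w => xi w ord0 i)).
  under [X in _ \o X]eq_fun do rewrite xiE.
  exact: EFin_integrableB.
have iW : P.-integrable setT (EFin \o (fun w => edot (xi w) (xi w))).
  apply: ge0_integrable.
  - by under eq_fun do rewrite -WE.
  - by move=> w; exact: edot_ge0.
  - apply: le_lt_trans intW _.
    by have /integrable_fin_num -/(_ measurableT) := isGG;
      rewrite fin_numElt => /andP[].
have xi0 A i : F A -> measurable A -> (\int[P]_(w in A) (xi w ord0 i)%:E = 0)%E.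
  move=> FA mA; under eq_integral do rewrite xiE.
  have iGA := integrableS measurableT mA (@subsetT _ _) (iG i).
  have igA := integrableS measurableT mA (@subsetT _ _) (ig i).
  rewrite integralB_EFin //; have [_ _ _ /(_ A FA) ->] := cg i.
  by rewrite subee // integrable_fin_num.
have [i1 e1] : P.-integrable setT (EFin \o (fun w => edot (x w - xs) (xi w))) /\
    \int[P]_w (edot (x w - xs) (xi w)) = 0.
  apply: (@Rintegral_edot_orthogonal _ _ _ _ _ F) => // i.
  under eq_fun do rewrite !mxE.
  have cpr : continuous (fun y : 'rV[R]_m => y ord0 i - xs ord0 i).
    move=> y; apply: (@continuousB _ _ _ (fun z : 'rV[R]_m => z ord0 i)
      (cst (xs ord0 i)) y).
      exact: coord_continuous.
    exact: cst_continuous.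
  exact: Fx cpr.
have [i2 e2] : P.-integrable setT (EFin \o (fun w => edot (G w) (xi w))) /\
    \int[P]_w (edot (G w) (xi w)) = 0.
  apply: (@Rintegral_edot_orthogonal _ _ _ _ _ F) => // i.
  by case: (cg i).
(* In [c], 2 eta comes from convexity and -2 L eta^2 from the term eta^2 |G|^2. The last group in
   [B] collects the cross terms of mean 0. *)
pose c := 2 * eta * (1 - eta * L).
pose B w := S w - c * D w + eta ^+ 2 * edot (xi w) (xi w)
  + (2 * eta ^+ 2 * edot (G w) (xi w) - 2 * eta * edot (x w - xs) (xi w)).
have S'B w : S' w <= B w.
  rewrite /S' xE (_ : x w - eta *: g w - xs =
    (x w - xs) - eta *: G w - eta *: xi w); last first.
    by rewrite /xi scalerBr opprB addrA subrK addrAC.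
  have h1 := ler_wpM2l (ltW eta0) (Dsub (x w)).
  have h2 := ler_wpM2l (sqr_ge0 eta) (gradD (x w)).
  rewrite /B /S /c /D -/(G w) in h1 h2 *.
  move: (x w - xs) (xi w) (G w) (f (x w) - b) h1 h2 => v y z a h1 h2.
  rewrite (edotC z v) in h1.
  rewrite !edotE (edotC z v) (edotC y v) (edotC y z); nra.
have iM : P.-integrable setT (EFin \o (fun w =>
    2 * eta ^+ 2 * edot (G w) (xi w) - 2 * eta * edot (x w - xs) (xi w))).
  by apply: EFin_integrableB; exact: EFin_integrableZl.
have iB : P.-integrable setT (EFin \o B).
  apply: EFin_integrableD iM.
  apply: EFin_integrableD; last exact: EFin_integrableZl.
  by apply: EFin_integrableB => //; exact: EFin_integrableZl.
have iS' : P.-integrable setT (EFin \o S').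
  apply: (EFin_le_integrable _ _ iB); first exact: measurable_edot.
  by move=> w; rewrite ger0_norm ?edot_ge0.
split=> //.
rewrite (le_trans (le_Rintegral _ iS' iB _)) //.
have -> : \int[P]_w B w = \int[P]_w S w - c * \int[P]_w D w +
    eta ^+ 2 * \int[P]_w edot (xi w) (xi w).
  have icD := EFin_integrableZl c iD.
  have ieW := EFin_integrableZl (eta ^+ 2) iW.
  have iScD := EFin_integrableB iS icD.
  have iScDW := EFin_integrableD iScD ieW.
  have i1' := EFin_integrableZl (2 * eta) i1.
  have i2' := EFin_integrableZl (2 * eta ^+ 2) i2.
  rewrite RintegralD // RintegralD // RintegralB // [X in _ + X]RintegralB //.
  by rewrite !RintegralZl // e1 e2 !mulr0 subrr addr0.
have IW : \int[P]_w edot (xi w) (xi w) <=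
    sigma ^+ 2 * \int[P]_w edot (G w) (G w).
  rewrite -RintegralZl //; apply: fine_le intW; exact: integrable_fin_num.
have IG : \int[P]_w edot (G w) (G w) <= 2 * L * \int[P]_w D w.
  rewrite -RintegralZl //; apply: le_Rintegral => //.
    exact: EFin_integrableZl.
  by move=> w _; exact: gradD.
(* The noise costs at most 2 L eta^2 sigma^2 E D, which lowers the coefficient [c] to 2 eta (1 - eta
   L (1 + sigma^2)). *)
have h1 := ler_wpM2l (sqr_ge0 sigma) IG.
have h2 := ler_wpM2l (sqr_ge0 eta) (le_trans IW h1).
rewrite /c; move: h2; set I := \int[P]_w D w; set J := \int[P]_w edot _ _.
nra.
Qed.

End sgd_step.

(* [inf] of a set that is not bounded below is 0, so that [f xs = inf f] is
   only meaningful together with [has_lbound]. *)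
Theorem corollary3p4 (R : realType) (m : nat) (d : measure_display)
    (T : measurableType d) (P : probability T R)
    (f : 'rV[R]_m -> R) (L sigma eta : R)
    (X g : nat -> T -> 'rV[R]_m)
    (f_convex : convex_function [set: convex_lmodType 'rV[R]_m] f)
    (f_diff : forall x, differentiable f x)
    (L_gt0 : 0 < L)
    (grad_lip : forall x y, enorm (grad f x - grad f y) <= L * enorm (x - y))
    (f_min : has_lbound (range f) /\ exists xs, f xs = inf (range f))
    (sigma_ge0 : 0 <= sigma)
    (eta_gt0 : 0 < eta)
    (eta_lt : eta < 1 / (L * (1 + sigma ^+ 2)))
    (X0_rv : random_vector (X 0%N))
    (g_rv : forall n, random_vector (g n))
    (X_step : forall n w, X n.+1 w = X n w - eta *: g n w)
    (g_unbiased : forall n,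
      is_cond_exp_rV P (natural_filtration X n) (g n)
        (fun w => grad f (X n w)))
    (g_variance : forall n, exists Z : T -> \bar R,
      is_cond_exp_ge0 P (natural_filtration X n)
        (fun w => enorm (g n w - grad f (X n w)) ^+ 2) Z /\
      {ae P, forall w,
        (Z w <= (sigma ^+ 2 * enorm (grad f (X n w)) ^+ 2)%:E)%E})
    (X0_moment : ('E_P[fun w => (f (X 0%N w) + enorm (X 0%N w) ^+ 2)%R] < +oo)%E) :
  {ae P, forall w, f (X n w) @[n --> \oo] --> inf (range f)} /\
  cvg_L1 P (fun n w => f (X n w)) (fun=> inf (range f)).
Proof.
have [flb [xs fxs]] := f_min; set b := inf (range f) in fxs *.
have D0 y : 0 <= f y - b by rewrite subr_ge0; apply: ge_inf => //; exists y.
have fb y : b <= f y by rewrite -subr_ge0.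
have gradD y := grad_sq_le f_diff y L_gt0 grad_lip fb.
(* At the minimizer [gradD] bounds the squared gradient by 2 L times 0. *)
have gxs : grad f xs = 0.
  apply: edot_eq0; apply/le_anti; rewrite edot_ge0 andbT.
  by rewrite (le_trans (gradD xs)) // fxs subrr mulr0.
have Dsub y : f y - b <= edot (grad f y) (y - xs).
  have := convex_ge_tangent f_diff y xs f_convex.
  by rewrite fxs -(opprB y xs) edotNr; lra.
have Dquad y : f y - b <= L / 2 * edot (y - xs) (y - xs).
  have := descent f_diff xs (y - xs) L_gt0 grad_lip.
  rewrite addrC subrK gxs fxs (_ : edot 0 _ = 0); first by lra.
  by rewrite -(scale0r 0) edotZl mul0r.
have cf : continuous f by move=> y; exact: differentiable_continuous.
have rX n : random_vector (X n).
  elim: n => // n IH; apply: random_vector_coord => i.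
  under eq_fun do rewrite X_step !mxE.
  apply: measurable_funB; first exact: measurable_coord.
  by apply: measurable_funM => //; exact: measurable_coord.
pose S n w := edot (X n w - xs) (X n w - xs).
pose D n w := f (X n w) - b.
pose kappa := 2 * eta * (1 - eta * (L * (1 + sigma ^+ 2))).
(* This is where the upper bound on the step size enters. *)
have kappa0 : 0 < kappa.
  have K0 : 0 < L * (1 + sigma ^+ 2) by rewrite mulr_gt0 // ltr_wpDr ?sqr_ge0.
  by rewrite !mulr_gt0 // subr_gt0 -ltr_pdivlMr.
have step n : P.-integrable setT (EFin \o S n) ->
  [/\ P.-integrable setT (EFin \o S n.+1), P.-integrable setT (EFin \o D n) &
      \int[P]_w S n.+1 w <= \int[P]_w S n w - kappa * \int[P]_w D n w].
  have [Z [cZ Zle]] := g_variance n.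
  apply: (sgd_step L_gt0 eta_gt0 cf gradD D0 Dsub Dquad
    (smallest_sigma_algebra _ _) (natural_filtration_measurable rX) (rX n)
    (rX n.+1) (g_rv n) _ (X_step n) (g_unbiased n) cZ Zle) => h.
  exact: natural_filtration_continuous.
have iS n : P.-integrable setT (EFin \o S n).
  elim: n => [|n /step[]] //.
  have mX0 i := measurable_coord i (rX 0%N).
  have mS0 : measurable_fun setT (S 0%N).
    apply: measurable_edot => i; under eq_fun do rewrite !mxE;
      exact: measurable_funB.
  pose u w := f (X 0%N w) + enorm (X 0%N w) ^+ 2.
  have iu : P.-integrable setT (EFin \o u).
    apply: (@lbounded_integrable _ _ _ _ _ b).
    - apply: measurable_funD; first exact: measurable_random_vector.
      by under eq_fun do rewrite sqr_enorm; exact: measurable_edot.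
    - by move=> w; rewrite ler_wpDr ?sqr_ge0.
    - by move: X0_moment; rewrite unlock.
  (* The constant comes from |x - xs|^2 <= 2 |x|^2 + 2 |xs|^2, where |x|^2 is then bounded by f(x) -
     b + |x|^2. *)
  pose C := - b + edot xs xs.
  have iuC : P.-integrable setT (EFin \o (fun w => u w + C)).
    by apply: EFin_integrableD => //; exact: finite_measure_integrable_cst.
  apply: (EFin_le_integrable mS0 _ (EFin_integrableZl 2 iuC)) => w.
  rewrite ger0_norm ?edot_ge0 // /u /C sqr_enorm /S.
  have := fb (X 0%N w); have := edot_ge0 (X 0%N w + xs).
  by rewrite !edotE (edotC xs); lra.
have iD n : P.-integrable setT (EFin \o D n) by have [] := step n (iS n).
have mD n : measurable_fun setT (D n).
  by apply/measurable_EFinP; exact: measurable_int (iD n).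
have ID0 n : 0 <= \int[P]_w D n w by apply: Rintegral_ge0 => w _; exact: D0.
(* The one-step inequalities telescope, and E S_n >= 0 leaves a bound uniform in n. *)
have sumD n : \sum_(k < n) \int[P]_w D k w <= (\int[P]_w S 0 w) / kappa.
  suff : \int[P]_w S n w <=
      \int[P]_w S 0 w - kappa * \sum_(k < n) \int[P]_w D k w.
    have : 0 <= \int[P]_w S n w by apply: Rintegral_ge0 => w _; exact: edot_ge0.
    by rewrite ler_pdivlMr // mulrC; lra.
  elim: n => [|n IH]; first by rewrite big_ord0 mulr0 subr0.
  have [_ _ /le_trans] := step n (iS n); apply.
  by rewrite big_ord_recr /= mulrDr; lra.
split.
  have : {ae P, forall w, D n w @[n --> \oo] --> 0}.
    apply: (@summable_ae_cvg0 _ _ _ _ _ ((\int[P]_w S 0 w) / kappa)) => //.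
      by move=> n w; exact: D0.
    move=> n; apply: (@le_trans _ _ (\sum_(k < n) \int[P]_w D k w)%:E).
      rewrite -sumEFin; apply: lee_sum => k _.
      by rewrite /Rintegral fineK ?lexx //;
        exact: (integrable_fin_num measurableT (iD k)).
    by rewrite lee_fin.
  apply: filterS => w Dw.
  rewrite (_ : (fun n => f (X n w)) = (fun n => D n w + b)); last first.
    by apply/funext => n; rewrite subrK.
  by rewrite -[X in _ --> X]add0r; apply: cvgD => //; exact: cvg_cst.
split.
- move=> n; rewrite (_ : (fun w => _) = (fun w => D n w + b)).
    apply: EFin_integrableD => //; exact: finite_measure_integrable_cst.
  by apply/funext => w; rewrite subrK.
- exact: finite_measure_integrable_cst.
(* Since D_n >= 0, the L^1 distance to inf f is E D_n, the term of a nonnegative series with bounded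
   partial sums. *)
- rewrite (_ : (fun n => _) = (fun n => (\int[P]_w D n w)%:E)); last first.
    apply/funext => n; rewrite unlock /Rintegral fineK.
      by apply: eq_integral => w _; rewrite ger0_norm //; exact: D0.
    exact: (integrable_fin_num measurableT (iD n)).
  apply: cvg_EFin; first exact: nearW.
  exact: (bounded_series_cvg0 ID0 sumD).
Qed.
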